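(* Let $m,n\ge 1$ be integers, let $X=[x_1,\dots,x_n]^T$ be a random vector in $\mathbb{R}^n$, and let $S=(S_{i,j})$ be an $m\times n$ random matrix; set $A=\frac{1}{\sqrt{m}}S$ and $C=\frac{m}{n}$. Suppose that all the random variables $x_i$ ($1\le i\le n$) and $S_{i,j}$ ($1\le i\le m$, $1\le j\le n$) are independent and identically distributed, with mean zero and variance one, and that they are sub-Gaussian with parameter $v=1$, i.e. $\mathbb{E}e^{\lambda Y}\le e^{\lambda^2/2}$ for all $\lambda\in\mathbb{R}$, where $Y$ denotes any of these variables. Then for all $t>0$: \begin{enumerate} \item $\displaystyle \mathbb{P}\left( \frac{1}{\sqrt{n}} \left| \|X\|^2 -n \right|> t \right) < 2\exp\left\{ - \min\left(\frac{t^2}{160}, \frac{t\sqrt{n}}{10}\right) \right\};$ \item $\displaystyle \mathbb{P}\left( \frac{1}{\sqrt{n}} \left| \|AX\|^2 - \|X\|^2 \right|> \frac{\|X\|^2}{n}\, t \right) < 2 \exp \left\{ -\min \left( \frac{t^2 C}{160} , \frac{t C \sqrt{n}}{10} \right) \right\}.$ \end{enumerate}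
   Context: $\|\cdot\|$ denotes the Euclidean norm. A real random variable $Y$ is called sub-Gaussian with parameter $v>0$ if $\mathbb{E}e^{\lambda Y}\le e^{\lambda^2 v/2}$ for all $\lambda\in\mathbb{R}$. *)

(* Defs.v *)
From HB Require Import structures.
From mathcomp Require Import all_boot all_order all_algebra.
From mathcomp Require Import all_classical all_reals all_analysis.
Set Implicit Arguments. Unset Strict Implicit. Unset Printing Implicit Defensive.
Import Order.TTheory GRing.Theory Num.Theory.
Local Open Scope classical_set_scope.
Local Open Scope ring_scope.

Definition mutually_independent {d} {T : measurableType d} {R : realType}
  (P : probability T R) (I : finType) (Z : I -> T -> R) : Prop :=
  forall (J : {set I}) (B : I -> set R),
    (forall j, measurable (B j)) ->
    P (\bigcap_(j in [set j | j \in J]) (Z j @^-1` B j)) =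
    (\prod_(j in J) P (Z j @^-1` B j))%E.

Definition identically_distributed {d} {T : measurableType d} {R : realType}
  (P : probability T R) (I : Type) (Z : I -> T -> R) : Prop :=
  forall i j (B : set R), measurable B -> P (Z i @^-1` B) = P (Z j @^-1` B).

Definition subgaussian {d} {T : measurableType d} {R : realType}
  (P : probability T R) (v : R) (Y : T -> R) : Prop :=
  forall l : R, ('E_P[fun w => expR (l * Y w)] <= (expR (l ^+ 2 * v / 2))%:E)%E.

Definition sqnorm {T : Type} {R : realType} (n : nat) (x : 'I_n -> T -> R) (w : T) : R :=
  \sum_(i < n) (x i w) ^+ 2.

Definition sqnormAX {T : Type} {R : realType} (m n : nat)
  (S : 'I_m -> 'I_n -> T -> R) (x : 'I_n -> T -> R) (w : T) : R :=
  \sum_(i < m) ((Num.sqrt m%:R)^-1 * \sum_(j < n) S i j w * x j w) ^+ 2.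

(* Main.v *)
Require Import Defs.
From HB Require Import structures.
From mathcomp Require Import all_boot all_order all_algebra.
From mathcomp Require Import all_classical all_reals all_analysis.
From mathcomp Require Import measurable_realfun ring lra.
Set Implicit Arguments. Unset Strict Implicit. Unset Printing Implicit Defensive.
Import Order.TTheory GRing.Theory Num.Theory.
Local Open Scope classical_set_scope.
Local Open Scope ring_scope.

(** A sub-Gaussian [U] with [E U^2 = 1] satisfies
    [E exp (s U^2) <= (1 - 2 s)^(-1/2)]: write [exp (s U^2)] as a Gaussian mean of
    [exp (sqrt (2 s) g U)] and exchange the two integrals. At [s = 1/5] this also
    bounds [E U^4], hence [E exp (- s U^2)], and Chernoff's method gives both tails
    for a sum of independent squares. The lower tail is strictly smaller than the
    announced bound, which makes the final inequality strict.

    For [A X], independence allows evaluating [X] and [S] at independent points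
    [w] and [w'] of [T]. For fixed [w] with [X w <> 0], the coordinates of
    [S (w') X(w) / |X(w)|] are independent, sub-Gaussian and of variance one, so the
    first part applies with [m] in place of [n], uniformly in [w]. *)

(** * Exponential moments of a squared sub-Gaussian variable *)

Section gaussian_linearisation.
Context (R : realType).
Local Notation mu := (@lebesgue_measure R).

(** Completing the square turns the integrand into a constant times the normal density with mean
    [b * y]. *)
Lemma integral_normal_pdf_expR (b y : R) :
  (\int[mu]_g (normal_pdf 0 1 g * expR (b * g * y))%:E =
   (expR (b ^+ 2 * y ^+ 2 / 2))%:E)%E.
Proof.
have one0 : (1 : R) != 0 by exact: oner_neq0.
transitivity (\int[mu]_g ((expR (b ^+ 2 * y ^+ 2 / 2))%:E
                           * (normal_pdf (b * y) 1 g)%:E))%E.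
  apply: eq_integral => g _; rewrite -EFinM !normal_pdfE// /normal_fun /=; congr EFin.
  rewrite -(mulrA (normal_peak 1)) [RHS]mulrCA.
  congr (_ * _); rewrite -!expRD; congr expR.
  by rewrite expr1n; field.
rewrite ge0_integralZl//.
- by rewrite integral_normal_pdf mule1.
- by apply/measurable_EFinP; exact: measurable_normal_pdf.
- by move=> g _; rewrite lee_fin normal_pdf_ge0.
Qed.

(** The exponents combine into [- (1 - 2 * s) * g ^+ 2 / 2], so the integrand is [r^-1] times the
    centred normal density of standard deviation [r^-1]. *)
Lemma integral_normal_pdf_expR_sqr (s : R) : s < 1 / 2 ->
  (\int[mu]_g (normal_pdf 0 1 g * expR (s * g ^+ 2))%:E =
   ((Num.sqrt (1 - 2 * s))^-1)%:E)%E.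
Proof.
move=> s2; set r := Num.sqrt _.
have r2 : r ^+ 2 = 1 - 2 * s by rewrite sqr_sqrtr; lra.
have r0 : 0 < r by rewrite sqrtr_gt0; lra.
have rN0 : r != 0 by rewrite gt_eqF.
transitivity (\int[mu]_g ((r^-1)%:E * (normal_pdf 0 r^-1 g)%:E))%E.
  apply: eq_integral => g _; rewrite -EFinM !normal_pdfE ?invr_eq0 ?oner_neq0//=.
  congr EFin; rewrite /normal_fun /normal_peak.
  rewrite -(mulrA _ (expR _)) -expRD !mulrA; congr (_ * expR _).
    rewrite expr1n mul1r -mulrnAr [in RHS]sqrtrM ?sqr_ge0// sqrtr_sqr.
    by rewrite gtr0_norm ?invr_gt0// invfM invrK mulrA mulVf// mul1r.
  rewrite subr0 expr1n exprVn r2;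
  by field; rewrite -r2 sqrf_eq0.
rewrite ge0_integralZl//.
- by rewrite integral_normal_pdf mule1.
- by apply/measurable_EFinP; exact: measurable_normal_pdf.
- by move=> g _; rewrite lee_fin normal_pdf_ge0.
- by rewrite lee_fin invr_ge0 ltW.
Qed.

Context (d : measure_display) (T : measurableType d) (P : probability T R).

Lemma subgaussian_expR_sqr (U : T -> R) (s : R) :
  measurable_fun setT U -> subgaussian P 1 U -> 0 <= s < 1 / 2 ->
  (\int[P]_w (expR (s * U w ^+ 2))%:E <= ((Num.sqrt (1 - 2 * s))^-1)%:E)%E.
Proof.
move=> mU sgU /andP[s0 s2]; pose b := Num.sqrt (2 * s).
have b2 : b ^+ 2 = 2 * s by rewrite sqr_sqrtr//; lra.
rewrite -(integral_normal_pdf_expR_sqr s2).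
under eq_integral => w _.
  rewrite (_ : s * _ = b ^+ 2 * U w ^+ 2 / 2); last by rewrite b2; field.
  rewrite -integral_normal_pdf_expR; over.
pose F (z : T * R) := (normal_pdf 0 1 z.2 * expR (b * z.2 * U z.1))%:E.
have mF : measurable_fun setT F.
  apply/measurable_EFinP/measurable_funM.
    by apply: measurableT_comp => //; exact: measurable_normal_pdf.
  apply: measurableT_comp => //; apply: measurable_funM; last first.
    exact: measurableT_comp.
  by apply: measurable_funM.
have F0 z : (0 <= F z)%E by rewrite lee_fin mulr_ge0 ?normal_pdf_ge0 ?expR_ge0.
rewrite (@fubini_tonelli _ _ _ _ _ P mu F)//.
apply: ge0_le_integral => //.
- by move=> g _; apply: integral_ge0.
- exact: measurable_fun_fubini_tonelli_G.
- apply/measurable_EFinP/measurable_funM; first exact: measurable_normal_pdf.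
  by apply: measurableT_comp => //; apply: measurable_funM.
move=> g _; rewrite /F /=.
under eq_integral do rewrite EFinM.
rewrite ge0_integralZl//; last first.
- by rewrite lee_fin normal_pdf_ge0.
- apply/measurable_EFinP; apply: measurableT_comp => //.
  exact: measurable_funM.
rewrite EFinM; apply: lee_wpmul2l; first by rewrite lee_fin normal_pdf_ge0.
(* The sub-Gaussian bound at [b * g] is [exp (b^2 g^2 / 2)], which equals [exp (s g^2)] since
   [b^2 = 2 s]. *)
have := sgU (b * g); rewrite unlock => /le_trans; apply.
rewrite lee_fin ler_expR exprMn b2; lra.
Qed.

End gaussian_linearisation.

(** * Independence as evaluation at independent sample points *)

Section decoupling.
Import numFieldNormedType.Exports.
Context (R : realType) (I : finType).

Definition box (B : I -> set R) : set (I -> R) := [set z | forall k, B k (z k)].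

(** A class closed under intersection that generates the product sigma-algebra on [I -> R]; laws of
    random vectors are compared on it. *)
Definition boxes : set (set (I -> R)) :=
  [set box B | B in [set B | forall k, measurable (B k)]].

Local Notation vec := (g_sigma_algebraType boxes).

Lemma measurable_vec_coord (k : I) : measurable_fun [set: vec] (fun z => z k).
Proof.
move=> _ A mA; rewrite setTI; apply: sub_sigma_algebra.
exists (fun j => if j == k then A else setT).
  by move=> j /=; case: ifP.
apply/seteqP; split => z /=.
  by move=> /(_ k); rewrite eqxx.
by move=> Az j; case: eqP => // ->.
Qed.

Lemma measurable_vec d (T : measurableType d) (f : T -> vec) :
  (forall k, measurable_fun setT (fun w => f w k)) -> measurable_fun setT f.
Proof.
move=> mf; apply: (@measurability _ _ T vec setT f boxes) => // _ [_ [B mB <-] <-].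
rewrite setTI.
have -> : f @^-1` box B = \bigcap_(k in [set: I]) ((fun w => f w k) @^-1` B k).
  by apply/seteqP; split => w /= h k; [move=> _|]; exact: h.
apply: fin_bigcap_measurable; first exact: finite_finset.
by move=> k _; rewrite -[X in measurable X]setTI; exact: mf.
Qed.

Lemma boxes_setI_closed : setI_closed boxes.
Proof.
move=> _ _ [A mA <-] [B mB <-]; exists (fun k => A k `&` B k).
  by move=> k; exact: measurableI.
by apply/seteqP; split => z /= => [h|[hA hB] k]; [split=> k; case: (h k)|split].
Qed.

Context (d : measure_display) (T : measurableType d) (P : probability T R).
Variable Z : I -> T -> R.
Hypothesis Zmeas : forall k, measurable_fun setT (Z k).
Hypothesis Zindep : mutually_independent P Z.

Lemma probability_box (J : {set I}) (B : I -> set R) :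
  (forall k, measurable (B k)) ->
  P [set w | forall k, k \in J -> B k (Z k w)] =
  (\prod_(k in J) P (Z k @^-1` B k))%E.
Proof. by move=> mB; rewrite -Zindep. Qed.

(* The coordinates in [J] are evaluated at [w.1], the others at an
   independent copy [w.2]. *)
Definition decouple (J : {set I}) (w : T * T) : vec :=
  fun k => if k \in J then Z k w.1 else Z k w.2.

Lemma measurable_decouple J : measurable_fun setT (decouple J).
Proof.
apply: measurable_vec => k; rewrite /decouple.
by case: (k \in J); exact: measurableT_comp.
Qed.

Let joint (w : T) : vec := fun k => Z k w.

Let mjoint : measurable_fun setT joint.
Proof. exact: measurable_vec. Qed.

(** By independence, the probability of a box splits into the factors in [J] and those outside, so
    both laws agree on [boxes]; uniqueness of measures extends this to all measurable sets. *)
Lemma pushforward_decouple (J : {set I}) (A : set vec) : measurable A ->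
  pushforward P joint A = pushforward (P \x P)%E (decouple J) A.
Proof.
have mD := measurable_decouple J.
pose law := measure_function_pushforward__canonical__measure_function_Measure.
pose m1 := law _ _ _ _ _ P _ mjoint; pose m2 := law _ _ _ _ _ (P \x P)%E _ mD.
move=> mA; apply: (@measure_unique _ R vec boxes (fun=> setT) erefl
  boxes_setI_closed _ _ m1 m2) => //.
- by move=> _; exists (fun=> setT) => //; apply/seteqP; split.
- by apply/seteqP; split => // z _; exists 0%N.
- move=> _ [B mB <-].
  change (P (joint @^-1` box B) = (P \x P)%E (decouple J @^-1` box B)).
  have -> : joint @^-1` box B = [set w | forall k, k \in [set: I]%SET -> B k (Z k w)].
    by apply/seteqP; split => w /= h k; [move=> _; exact: h|apply: h; rewrite inE].
  (* The preimage of a box is a rectangle: the constraints in [J] bear on the first sample point,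
     the others on the second. *)
  have -> : decouple J @^-1` box B =
      [set w | forall k, k \in J -> B k (Z k w)] `*`
      [set w | forall k, k \in ~: J -> B k (Z k w)].
    apply/seteqP; split => w /=.
      move=> h; split=> k kJ; have := h k; rewrite /decouple; last move: kJ.
        by rewrite kJ.
      by rewrite inE => /negbTE ->.
    move=> [h1 h2] k; rewrite /decouple; case: ifPn => kJ; first exact: h1.
    by apply: h2; rewrite inE.
  have mB' (K : {set I}) : measurable [set w | forall k, k \in K -> B k (Z k w)].
    rewrite (_ : mkset _ = \bigcap_(k in [set k | k \in K]) (Z k @^-1` B k))//.
    apply: fin_bigcap_measurable; first exact: finite_finset.
    by move=> k _; rewrite -[X in measurable X]setTI; exact: Zmeas.
  rewrite product_measure1E// probability_box//.
  rewrite [LHS](bigID (mem J))/=; congr (_ * _)%E.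
    rewrite [RHS](@probability_box J B mB).
    by apply: eq_bigl => k; rewrite !inE.
  rewrite [RHS](@probability_box (~: J) B mB).
  by apply: eq_bigl => k; rewrite !inE.
- by move=> _; change (P setT < +oo)%E; rewrite probability_setT ltry.
Qed.

Lemma integral_decouple (J : {set I}) (F : vec -> \bar R) :
  measurable_fun setT F -> (forall z, 0 <= F z)%E ->
  (\int[P]_w F (fun k => Z k w) =
   \int[P]_w \int[P]_w' F (decouple J (w, w')))%E.
Proof.
move=> mF F0; have mD := measurable_decouple J.
rewrite -(@fubini_tonelli1 _ _ _ _ _ P P (F \o decouple J))//; last 2 first.
- exact: measurableT_comp.
- by move=> z; exact: F0.
rewrite -[LHS](@ge0_integral_pushforward _ _ _ _ _ _ mjoint P setT F)//.
rewrite -[RHS](@ge0_integral_pushforward _ _ _ _ _ _ mD (P \x P)%E setT F)//.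
apply: eq_measure_integral => A mA _; exact: pushforward_decouple.
Qed.

(** [c] assigns each coordinate to a block, or to none with [None]. Decoupling block [i] from the
    rest makes [f i] a function of [w] and the remaining factors functions of [w'], so the double
    integral splits; induction on [L] does the rest. *)
Lemma integral_prod_blocks_in (K : finType) (c : I -> option K) (f : K -> vec -> R)
    (L : {set K}) :
  (forall i, measurable_fun setT (f i)) -> (forall i z, 0 <= f i z) ->
  (forall i z z', (forall k, c k = Some i -> z k = z' k) -> f i z = f i z') ->
  (\int[P]_w (\prod_(i in L) f i (fun k => Z k w))%:E =
   \prod_(i in L) \int[P]_w (f i (fun k => Z k w))%:E)%E.
Proof.
move=> mf f0 fc; have [N] := ubnP #|L|; elim: N L => // N IH L LN.
have [->|[i iL]] := set_0Vmem L.
  under eq_integral do rewrite big_set0.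
  rewrite big_set0 integral_cst// mul1e; exact: probability_setT.
have mprod (L' : {set K}) : measurable_fun setT (fun z : vec => \prod_(j in L') f j z).
  rewrite [X in measurable_fun _ X](_ : _ = fun z => \prod_(j <- enum L') f j z).
    exact: measurable_prod.
  by apply/funext => z; rewrite big_enum.
rewrite (big_setD1 i)//= -IH; last first.
  by move: LN; rewrite (cardsD1 i) iL.
rewrite (@integral_decouple [set k | c k == Some i]
  (fun z => (\prod_(j in L) f j z)%:E)); last 2 first.
- exact/measurable_EFinP.
- by move=> z; rewrite lee_fin prodr_ge0.
under eq_integral => w _.
  under eq_integral => w' _.
    rewrite (big_setD1 i)//= (fc i _ (fun k => Z k w)); last first.
      by move=> k ck; rewrite /decouple inE ck eqxx.
    rewrite (eq_bigr (fun j => f j (fun k => Z k w'))); last first.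
      move=> j; rewrite !inE => /andP[/negbTE ji _]; apply: fc => k ck.
      by rewrite /decouple inE ck (inj_eq Some_inj) ji.
    rewrite EFinM; over.
  rewrite ge0_integralZl//; last 3 first.
  - by apply/measurable_EFinP; exact: (measurableT_comp (mprod _)).
  - by move=> w' _; rewrite lee_fin prodr_ge0.
  - by rewrite lee_fin.
  over.
rewrite ge0_integralZr//.
- by apply/measurable_EFinP; exact: (measurableT_comp (mf i)).
- by move=> w _; rewrite lee_fin.
- by apply: integral_ge0 => w _; rewrite lee_fin prodr_ge0.
Qed.

Lemma integral_prod_blocks (K : finType) (c : I -> option K) (f : K -> vec -> R) :
  (forall i, measurable_fun setT (f i)) -> (forall i z, 0 <= f i z) ->
  (forall i z z', (forall k, c k = Some i -> z k = z' k) -> f i z = f i z') ->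
  (\int[P]_w (\prod_i f i (fun k => Z k w))%:E =
   \prod_i \int[P]_w (f i (fun k => Z k w))%:E)%E.
Proof.
move=> mf f0 fc; have := integral_prod_blocks_in [set: K]%SET mf f0 fc.
rewrite (eq_bigl xpredT) => [<-|i]; last by rewrite inE.
by apply: eq_integral => w _; congr EFin; apply: eq_bigl => i; rewrite inE.
Qed.

End decoupling.

(** * Explicit quadratic bounds for [E exp (s U^2)] and [E exp (- s U^2)] *)

Section square_exponential_moments.
Context (R : realType) (d : measure_display) (T : measurableType d).
Variables (P : probability T R) (U : T -> R).
Hypothesis mU : measurable_fun setT U.
Hypothesis sgU : subgaussian P 1 U.
Hypothesis U2 : (\int[P]_w (U w ^+ 2)%:E = 1)%E.

(** After squaring and using [1 + y <= exp y], it suffices that [(1 - 2 s) (1 + 2 s + 10 s^2) = 1 +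
    6 s^2 - 20 s^3] be at least 1, which holds for [s] up to 3/10. *)
Lemma integral_expR_sqr_le (s : R) : 0 <= s <= 1 / 5 ->
  (\int[P]_w (expR (s * U w ^+ 2))%:E <= (expR (s + 5 * s ^+ 2))%:E)%E.
Proof.
move=> /andP[s0 s5].
have s2 : 0 <= s < 1 / 2 by lra.
apply: (le_trans (subgaussian_expR_sqr mU sgU s2)); rewrite lee_fin.
set r := Num.sqrt _.
have r2 : r ^+ 2 = 1 - 2 * s by rewrite sqr_sqrtr; lra.
have r0 : 0 < r by rewrite sqrtr_gt0; lra.
set e := expR _.
have e0 : 0 < e by exact: expR_gt0.
have e2 : 1 + (2 * s + 10 * s ^+ 2) <= e ^+ 2.
  have := expR_ge1Dx (2 * s + 10 * s ^+ 2).
  suff -> : expR (2 * s + 10 * s ^+ 2) = e ^+ 2 by [].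
  by rewrite [RHS]expr2 -expRD; congr expR; ring.
rewrite -(ler_pM2l r0) mulfV ?gt_eqF//.
suff : 1 ^+ 2 <= (r * e) ^+ 2 by rewrite ler_pXn2r// nnegrE ?mulr_ge0// ltW.
rewrite exprMn r2 expr1n.
have : (1 - 2 * s) * (1 + (2 * s + 10 * s ^+ 2)) <= (1 - 2 * s) * e ^+ 2.
  by apply: ler_wpM2l => //; lra.
apply: le_trans; nra.
Qed.

(** Integrating [1 + U^2 / 5 + U^4 / 100 <= exp (U^2 / 5)] and bounding the right side by 13/10
    leaves at most 1/10 for [E U^4 / 100]. *)
Lemma integral_pow4_le : (\int[P]_w (U w ^+ 4)%:E <= 10%:E)%E.
Proof.
have m2 : measurable_fun setT (fun w => (U w ^+ 2)%:E).
  by apply/measurable_EFinP; exact: measurable_funX.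
have m4 : measurable_fun setT (fun w => (U w ^+ 4)%:E).
  by apply/measurable_EFinP; exact: measurable_funX.
have p2 w : (0 <= (U w ^+ 2)%:E)%E by rewrite lee_fin sqr_ge0.
have p4 w : (0 <= (U w ^+ 4)%:E)%E by rewrite lee_fin exprn_even_ge0.
have s5 : 0 <= (1 / 5 : R) < 1 / 2 by lra.
(* The constant works because [(10 / 13)^2 = 100 / 169 < 3 / 5]. *)
have root : (Num.sqrt (1 - 2 * (1 / 5 : R)))^-1 <= 13 / 10.
  rewrite -[leRHS]invrK lef_pV2 ?posrE ?invr_gt0 ?sqrtr_gt0; [|lra|lra].
  rewrite -[leLHS]ger0_norm ?invr_ge0; last lra.
  by rewrite -sqrtr_sqr ler_sqrt; lra.
have : (1 + ((1 / 5)%:E * \int[P]_w (U w ^+ 2)%:E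
         + (1 / 100)%:E * \int[P]_w (U w ^+ 4)%:E) <= (13 / 10 : R)%:E)%E.
  apply: le_trans; last first.
    apply: (le_trans (subgaussian_expR_sqr mU sgU s5)).
    by rewrite lee_fin; exact: root.
  have <- : (\int[P]_w 1 = 1)%E.
    by rewrite integral_cst// mul1e; exact: probability_setT.
  rewrite -ge0_integralZl//; rewrite -ge0_integralZl//.
  rewrite -ge0_integralD//; last 4 first.
  - by move=> w _; rewrite mule_ge0// lee_fin; lra.
  - exact: measurable_funeM.
  - by move=> w _; rewrite mule_ge0// lee_fin; lra.
  - exact: measurable_funeM.
  rewrite -ge0_integralD//; last 2 first.
  - by move=> w _; rewrite adde_ge0// mule_ge0// lee_fin; lra.
  - by apply: emeasurable_funD; exact: measurable_funeM.
  apply: ge0_le_integral => //.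
  - by move=> w _; rewrite !adde_ge0// mule_ge0// lee_fin; lra.
  - apply: emeasurable_funD => //.
    by apply: emeasurable_funD; exact: measurable_funeM.
  - apply/measurable_EFinP; apply: measurableT_comp => //.
    by apply: measurable_funM => //; exact: measurable_funX.
  move=> w _; rewrite -!EFinM -!EFinD lee_fin.
  (* [(1 + y)^2 <= exp (2 y)] with [y = U^2 / 10] *)
  have := expR_ge1Dx (1 / 10 * U w ^+ 2).
  set y := 1 / 10 * _; set e := expR y => ye.
  have -> : expR (1 / 5 * U w ^+ 2) = e ^+ 2.
    by rewrite [RHS]expr2 -expRD; congr expR; rewrite /y; field.
  have y0 : 0 <= y by rewrite mulr_ge0 ?sqr_ge0//; lra.
  apply: (@le_trans _ _ ((1 + y) ^+ 2)); last first.
    by rewrite ler_pXn2r// nnegrE; [lra|exact: expR_ge0].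
  by rewrite /y le_eqVlt; apply/orP; left; apply/eqP; field.
rewrite U2 mule1.
(* An infinite fourth moment is excluded, since it would make the left side infinite. *)
case: (\int[P]_w (U w ^+ 4)%:E)%E (integral_ge0 P (fun w (_ : setT w) => p4 w)) =>
  [v| |]//= _.
  rewrite -EFinM -!EFinD !lee_fin; lra.
by rewrite gt0_muley ?lte_fin//; lra.
Qed.

Lemma integral_expR_Nsqr_le (s : R) : 0 <= s ->
  (\int[P]_w (expR (- s * U w ^+ 2))%:E <= (expR (- s + 10 * s ^+ 2))%:E)%E.
Proof.
move=> s0.
have m2 : measurable_fun setT (fun w => (U w ^+ 2)%:E).
  by apply/measurable_EFinP; exact: measurable_funX.
have m4 : measurable_fun setT (fun w => (U w ^+ 4)%:E).
  by apply/measurable_EFinP; exact: measurable_funX.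
have p2 w : (0 <= (U w ^+ 2)%:E)%E by rewrite lee_fin sqr_ge0.
have p4 w : (0 <= (U w ^+ 4)%:E)%E by rewrite lee_fin exprn_even_ge0.
have me : measurable_fun setT (fun w => (expR (- s * U w ^+ 2))%:E).
  apply/measurable_EFinP; apply: measurableT_comp => //.
  by apply: measurable_funM => //; exact: measurable_funX.
have s20 : (0 <= (s ^+ 2)%:E)%E by rewrite lee_fin sqr_ge0.
(* The linear term stays on the left, so that all integrands are nonnegative and no integrals are
   subtracted. *)
have le1 : (\int[P]_w (expR (- s * U w ^+ 2))%:E + s%:E * \int[P]_w (U w ^+ 2)%:E
         <= 1 + (s ^+ 2)%:E * \int[P]_w (U w ^+ 4)%:E)%E.
  have <- : (\int[P]_w 1 = 1)%E.
    by rewrite integral_cst// mul1e; exact: probability_setT.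
  rewrite -ge0_integralZl//; rewrite -ge0_integralZl//.
  rewrite -ge0_integralD//; last 2 first.
  - by move=> w _; rewrite mule_ge0.
  - exact: measurable_funeM.
  rewrite -ge0_integralD//; last 2 first.
  - by move=> w _; rewrite mule_ge0.
  - exact: measurable_funeM.
  apply: ge0_le_integral => //.
  - by move=> w _; rewrite adde_ge0 ?mule_ge0// lee_fin expR_ge0.
  - by apply: emeasurable_funD => //; exact: measurable_funeM.
  - by apply: emeasurable_funD => //; exact: measurable_funeM.
  (* [exp (- y) <= 1 / (1 + y) <= 1 - y + y^2] *)
  move=> w _; rewrite -!EFinM -!EFinD lee_fin.
  have := expR_ge1Dx (s * U w ^+ 2).
  have y0 : 0 <= s * U w ^+ 2 by rewrite mulr_ge0 ?sqr_ge0.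
  rewrite mulNr expRN (_ : s ^+ 2 * U w ^+ 4 = (s * U w ^+ 2) ^+ 2); last by ring.
  move: (s * _) y0 => y y0 ye.
  have : (expR y)^-1 <= (1 + y)^-1 by rewrite lef_pV2 ?posrE ?expR_gt0//; lra.
  have : (1 + y)^-1 <= 1 - y + y ^+ 2.
    rewrite -[leLHS]div1r ler_pdivrMr; nra.
  lra.
rewrite U2 mule1 in le1.
have : (\int[P]_w (expR (- s * U w ^+ 2))%:E + s%:E <= (1 + s ^+ 2 * 10)%:E)%E.
  apply: (le_trans le1); rewrite EFinD (EFinM (s ^+ 2) 10) leeD2l// lee_wpmul2l//.
  exact: integral_pow4_le.
case: (integral _ _ _) => [v| |]//=; last by move=> _; exact: leNye.
rewrite -EFinD !lee_fin => h.
by have := expR_ge1Dx (- s + 10 * s ^+ 2); lra.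
Qed.

End square_exponential_moments.

(** * Unit linear combinations of independent sub-Gaussian variables *)

Section linear_combinations.
Import numFieldNormedType.Exports.
Context (R : realType) (d : measure_display) (T : measurableType d).
Variable P : probability T R.

(** [1 + U^2] dominates [|U|] and is integrable for a probability measure. *)
Lemma integrable_sqr (U : T -> R) : measurable_fun setT U ->
  (\int[P]_w (U w ^+ 2)%:E < +oo)%E -> P.-integrable setT (EFin \o U).
Proof.
move=> mU U2.
have m2 : measurable_fun setT (fun w => (U w ^+ 2)%:E).
  by apply/measurable_EFinP; exact: measurable_funX.
have i2 : P.-integrable setT (fun w => (U w ^+ 2)%:E).
  apply/integrableP; split => //.
  by under eq_integral do rewrite gee0_abs ?lee_fin ?sqr_ge0//.
have i1 : P.-integrable setT (cst 1%:E).
  by apply: finite_measure_integrable_cst.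
apply: (le_integrable _ _ _ (integrableD measurableT i1 i2)) => //.
  exact/measurable_EFinP.
move=> w _; rewrite /= lee_fin.
rewrite [leRHS]ger0_norm ?addr_ge0 ?sqr_ge0// -[X in 1 + X]real_normK ?num_real//.
by have := normr_ge0 (U w); nra.
Qed.

Lemma integral_sqr_shift (U : T -> R) (c v : R) : measurable_fun setT U ->
  (\int[P]_w (U w)%:E = 0)%E -> (\int[P]_w (U w ^+ 2)%:E = v%:E)%E ->
  (\int[P]_w ((c + U w) ^+ 2)%:E = (c ^+ 2 + v)%:E)%E.
Proof.
move=> mU U1 U2.
have iU : P.-integrable setT (EFin \o U).
  by apply: integrable_sqr => //; rewrite U2 ltry.
have i2 : P.-integrable setT (fun w => (U w ^+ 2)%:E).
  apply/integrableP; split; first by apply/measurable_EFinP; exact: measurable_funX.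
  by under eq_integral do rewrite gee0_abs ?lee_fin ?sqr_ge0//; rewrite U2 ltry.
have i1 : P.-integrable setT (cst (c ^+ 2)%:E).
  by apply: finite_measure_integrable_cst.
have iZ : P.-integrable setT (fun w => (2 * c)%:E * (U w)%:E)%E.
  exact: integrableZl.
transitivity (\int[P]_w ((c ^+ 2)%:E + ((2 * c)%:E * (U w)%:E + (U w ^+ 2)%:E)))%E.
  by apply: eq_integral => w _; rewrite -EFinM -!EFinD; congr EFin; ring.
rewrite integralD//; last exact: integrableD.
rewrite integralD// integralZl// U1 U2 mule0 add0e integral_cst// EFinD.
by rewrite [X in (_ * X)%E](_ : _ = 1%E) ?mule1//; exact: probability_setT.
Qed.

Context (I : finType) (Z : I -> T -> R).
Hypothesis Zmeas : forall k, measurable_fun setT (Z k).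
Hypothesis Zindep : mutually_independent P Z.

Lemma measurable_lincomb (a : I -> R) (J : {set I}) :
  measurable_fun setT (fun w => \sum_(k in J) a k * Z k w).
Proof.
rewrite [X in measurable_fun _ X](_ : _ = fun w => \sum_(k <- enum J) a k * Z k w).
  by apply: measurable_sum => k; exact: measurable_funM.
by apply/funext => w; rewrite big_enum.
Qed.

(** Moment generating functions of independent terms multiply, and the parameters [a k ^+ 2] add up
    to 1. *)
Lemma subgaussian_lincomb (a : I -> R) (J : {set I}) :
  (forall k, subgaussian P 1 (Z k)) -> \sum_(k in J) a k ^+ 2 = 1 ->
  subgaussian P 1 (fun w => \sum_(k in J) a k * Z k w).
Proof.
move=> sgZ a1 l; rewrite unlock.
under eq_integral do rewrite mulr_sumr expR_sum.
rewrite (@integral_prod_blocks_in _ _ _ _ _ _ Zmeas Zindep I (fun k => Some k)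
  (fun k z => expR (l * (a k * z k)))); last 3 first.
- move=> k; apply: measurableT_comp => //; do 2!apply: measurable_funM => //.
  exact: measurable_vec_coord.
- by move=> k z; exact: expR_ge0.
- by move=> k z z' zz'; rewrite (zz' k).
apply: (@le_trans _ _ (\prod_(k in J) (expR ((l * a k) ^+ 2 * 1 / 2))%:E)%E).
  (* Nonnegativity is carried through the induction because multiplying inequalities requires it. *)
  apply: (@proj2 (0 <= \prod_(k in J) \int[P]_w (expR (l * (a k * Z k w)))%:E)%E).
  elim/big_ind2: _ => [|x1 x2 y1 y2 [? ?] [? ?]|k _]; first by rewrite lee01.
    by split; [exact: mule_ge0|exact: lee_pmul].
  split; first by apply: integral_ge0 => w _; rewrite lee_fin expR_ge0.
  have := sgZ k (l * a k); rewrite unlock.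
  by under eq_integral do rewrite -mulrA.
rewrite prodEFin -expR_sum lee_fin ler_expR -!mulr_suml.
under eq_bigr do rewrite exprMn.
by rewrite -mulr_sumr a1 !mulr1.
Qed.

(** Induction on [J]: decoupling one coordinate makes it a constant shift in the inner integral,
    where the cross term vanishes by centring. Decoupling acts on the nonnegative square, so no
    signed product is integrated over the pair of points. *)
Lemma integral_lincomb_sqr (a : I -> R) (J : {set I}) :
  (forall k, \int[P]_w (Z k w)%:E = 0)%E ->
  (forall k, \int[P]_w (Z k w ^+ 2)%:E = 1)%E ->
  (\int[P]_w ((\sum_(k in J) a k * Z k w) ^+ 2)%:E =
   (\sum_(k in J) a k ^+ 2)%:E)%E.
Proof.
move=> Z1 Z2.
have iZ k : P.-integrable setT (EFin \o Z k).
  by apply: integrable_sqr => //; rewrite Z2 ltry.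
have W1 (L : {set I}) : (\int[P]_w (\sum_(k in L) a k * Z k w)%:E = 0)%E.
  under eq_integral do rewrite -sumEFin.
  rewrite integral_sum//.
    rewrite big1// => k _; under eq_integral do rewrite EFinM.
    by rewrite -[RHS](mule0 (a k)%:E) -(Z1 k) -(integralZl measurableT (iZ k)).
  move=> k; under eq_fun do rewrite EFinM; exact: (integrableZl measurableT _ (iZ k)).
have [N] := ubnP #|J|; elim: N J => // N IH J JN.
have [->|[i iJ]] := set_0Vmem J.
  under eq_integral do rewrite big_set0 expr0n.
  by rewrite big_set0 integral_cst// mul0e.
have {}IH : (\int[P]_w ((\sum_(k in J :\ i) a k * Z k w) ^+ 2)%:E =
    (\sum_(k in J :\ i) a k ^+ 2)%:E)%E.
  by apply: IH; move: JN; rewrite (cardsD1 i) iJ.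
rewrite (@integral_decouple _ _ _ _ _ _ Zmeas Zindep [set i]
  (fun z => ((\sum_(k in J) a k * z k) ^+ 2)%:E)); last 2 first.
- apply/measurable_EFinP/measurable_funX.
  rewrite [X in measurable_fun _ X](_ : _ = fun z => \sum_(k <- enum J) a k * z k).
    apply: measurable_sum => k; apply: measurable_funM => //.
    exact: measurable_vec_coord.
  by apply/funext => w; rewrite big_enum.
- by move=> z; rewrite lee_fin sqr_ge0.
transitivity
  (\int[P]_w (\sum_(k in J :\ i) a k ^+ 2 + (a i * Z i w) ^+ 2)%:E)%E.
  apply: eq_integral => w _.
  rewrite addrC -(integral_sqr_shift _ (measurable_lincomb a (J :\ i)) (W1 _) IH).
  apply: eq_integral => w' _.
  rewrite (big_setD1 i)//= /decouple inE eqxx; congr ((_ + _) ^+ 2)%:E.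
  by apply: eq_bigr => k; rewrite !inE => /andP[/negbTE -> _].
have p0 : 0 <= \sum_(k in J :\ i) a k ^+ 2 by apply: sumr_ge0 => k _; exact: sqr_ge0.
under eq_integral do rewrite EFinD exprMn EFinM.
rewrite ge0_integralD//; last 2 first.
- by move=> w _; rewrite mule_ge0// lee_fin sqr_ge0.
- by apply: measurable_funeM; apply/measurable_EFinP; exact: measurable_funX.
rewrite integral_cst// ge0_integralZl//; last 3 first.
- by apply/measurable_EFinP; exact: measurable_funX.
- by move=> w _; rewrite lee_fin sqr_ge0.
- by rewrite lee_fin sqr_ge0.
rewrite Z2 mule1 [X in (_ * X)%E](_ : _ = 1%E) ?mule1//; last exact: probability_setT.
by rewrite -EFinD addrC [in RHS](big_setD1 i).
Qed.

End linear_combinations.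

Lemma measurable_set_ltr (R : realType) (d : measure_display)
    (T : measurableType d) (f g : T -> R) :
  measurable_fun setT f -> measurable_fun setT g -> measurable [set w | f w < g w].
Proof.
move=> mf mg; rewrite (_ : mkset _ = ~` [set w | g w <= f w]); last first.
  by apply/seteqP; split => w /=; rewrite ltNge => /negP.
apply: measurableC; rewrite -[X in measurable X]setTI.
exact: measurable_fun_le.
Qed.

(** * Chernoff bounds for a sum of squares *)

Section chi_square_concentration.
Context (R : realType) (d : measure_display) (T : measurableType d).
Variable P : probability T R.

Lemma chernoff_le (Y : T -> R) (s a c : R) : measurable_fun setT Y -> 0 < s ->
  (\int[P]_w (expR (s * Y w))%:E <= (expR c)%:E)%E ->
  (P [set w | a <= Y w]%R <= (expR (c - s * a))%:E)%E.
Proof.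
move=> mY s0 Ys.
pose RVY : {RV P >-> R} := HB.pack Y (isMeasurableFun.Build _ _ _ _ _ mY).
apply: (le_trans (chernoff RVY a s0)).
rewrite expRD EFinM; apply: lee_wpmul2r; first by rewrite lee_fin expR_ge0.
apply: le_trans Ys; rewrite /mmt_gen_fun unlock le_eqVlt; apply/orP; left; apply/eqP.
by apply: eq_integral => w _ /=; rewrite mulrC.
Qed.

Variables (m : nat) (u : 'I_m -> T -> R).
Hypothesis m0 : (0 < m)%N.
Hypothesis mu : forall i, measurable_fun setT (u i).
Hypothesis sgu : forall i, subgaussian P 1 (u i).
Hypothesis u2 : forall i, (\int[P]_w (u i w ^+ 2)%:E = 1)%E.
(** Independence enters in this form, which [integral_prod_blocks] supplies both for the entries of
    [X] and for the rows of [S]. *)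
Hypothesis uprod : forall c, (\int[P]_w (\prod_i expR (c * u i w ^+ 2))%:E =
  \prod_i \int[P]_w (expR (c * u i w ^+ 2))%:E)%E.

Lemma measurable_sqnorm : measurable_fun setT (sqnorm u).
Proof. by apply: measurable_sum => i; exact: measurable_funX. Qed.

Lemma integral_expR_sqnorm_le (c b : R) :
  (forall i, \int[P]_w (expR (c * u i w ^+ 2))%:E <= (expR b)%:E)%E ->
  (\int[P]_w (expR (c * sqnorm u w))%:E <= (expR (m%:R * b))%:E)%E.
Proof.
move=> ub; under eq_integral do rewrite mulr_sumr expR_sum.
rewrite uprod.
apply: (@le_trans _ _ (\prod_(i < m) (expR b)%:E)%E).
  apply: (@proj2 (0 <= \prod_i \int[P]_w (expR (c * u i w ^+ 2))%:E)%E).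
  elim/big_ind2: _ => [|x1 x2 y1 y2 [? ?] [? ?]|i _]; first by rewrite lee01.
    by split; [exact: mule_ge0|exact: lee_pmul].
  by split=> //; apply: integral_ge0 => w _; rewrite lee_fin expR_ge0.
by rewrite prodEFin -expR_sum sumr_const card_ord mulr_natl.
Qed.

(** The Chernoff exponent [5 m s^2 - s tau] is least at [s = tau / (10 m)], with value
    [- tau^2 / (20 m)]. The moment bound restricts [s] to at most 1/5, hence two regimes. *)
Lemma sqnorm_upper_tail (tau : R) : 0 < tau ->
  (P [set w | m%:R + tau <= sqnorm u w]%R <=
   (expR (- Num.min (tau ^+ 2 / (160 * m%:R)) (tau / 10)))%:E)%E.
Proof.
move=> tau0; have m0' : 0 < m%:R :> R by rewrite ltr0n.
have mN0 : m%:R != 0 :> R by rewrite gt_eqF.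
have tail s : 0 < s <= 1 / 5 -> (P [set w | m%:R + tau <= sqnorm u w]%R <=
    (expR (5 * m%:R * s ^+ 2 - s * tau))%:E)%E.
  move=> /andP[s0 s5].
  have s05 : 0 <= s <= 1 / 5 by lra.
  have h := integral_expR_sqnorm_le
    (fun i => integral_expR_sqr_le (mu i) (@sgu i) s05).
  apply: (le_trans (chernoff_le _ measurable_sqnorm s0 h)).
  by rewrite lee_fin ler_expR; nra.
have [st|st] := leP (tau / (10 * m%:R)) (1 / 5).
  apply: (le_trans (tail (tau / (10 * m%:R)) _)); first by rewrite st divr_gt0// mulr_gt0.
  rewrite lee_fin ler_expR lerNr ge_min; apply/orP; left.
  rewrite -subr_ge0.
  have -> : - (5 * m%:R * (tau / (10 * m%:R)) ^+ 2 - tau / (10 * m%:R) * tau)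
            - tau ^+ 2 / (160 * m%:R) = tau ^+ 2 / m%:R * (7 / 160) by field.
  by rewrite mulr_ge0 ?divr_ge0 ?sqr_ge0//; lra.
(* Here [tau > 2 m], so the exponent [m / 5 - tau / 5] at the endpoint is below [- tau / 10]. *)
apply: (le_trans (tail (1 / 5) _)); first by lra.
rewrite lee_fin ler_expR lerNr ge_min; apply/orP; right.
move: st; rewrite ltr_pdivlMr ?mulr_gt0//; lra.
Qed.

(** The exponent [10 m s^2 - s tau] is minimised at [s = tau / (20 m)]; the negative moment bound
    holds for all [s >= 0], so there is a single regime. *)
Lemma sqnorm_lower_tail (tau : R) : 0 < tau ->
  (P [set w | sqnorm u w <= m%:R - tau]%R <=
   (expR (- (tau ^+ 2 / (40 * m%:R))))%:E)%E.
Proof.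
move=> tau0; have m0' : 0 < m%:R :> R by rewrite ltr0n.
have mN0 : m%:R != 0 :> R by rewrite gt_eqF.
have s0 : 0 < tau / (20 * m%:R) by rewrite divr_gt0// mulr_gt0.
have h := integral_expR_sqnorm_le
  (fun i => integral_expR_Nsqr_le (mu i) (@sgu i) (u2 i) (ltW s0)).
have mN : measurable_fun setT (fun w => - sqnorm u w).
  by apply: measurableT_comp => //; exact: measurable_sqnorm.
have hN : (\int[P]_w (expR (tau / (20 * m%:R) * - sqnorm u w))%:E <=
    (expR (m%:R * (- (tau / (20 * m%:R)) + 10 * (tau / (20 * m%:R)) ^+ 2)))%:E)%E.
  by under eq_integral do rewrite mulrN -mulNr.
rewrite [X in P X](_ : _ = [set w | tau - m%:R <= - sqnorm u w]); last first.
  by apply/seteqP; split => w /=; lra.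
apply: (le_trans (chernoff_le _ mN s0 hN)).
rewrite lee_fin ler_expR le_eqVlt; apply/orP; left; apply/eqP.
by field.
Qed.

(** A union bound; the two tails remain a sum because their gap yields strictness in
    [tail_sum_lt]. *)
Lemma sqnorm_concentration (tau : R) : 0 < tau ->
  (P [set w | tau < `|sqnorm u w - m%:R| ]%R <=
   (expR (- Num.min (tau ^+ 2 / (160 * m%:R)) (tau / 10))
    + expR (- (tau ^+ 2 / (40 * m%:R))))%:E)%E.
Proof.
move=> tau0; have mS := measurable_sqnorm.
have mup : measurable [set w | m%:R + tau <= sqnorm u w].
  rewrite -[X in measurable X]setTI.
  by apply: (measurable_fun_le (f := fun=> _)).
have mlo : measurable [set w | sqnorm u w <= m%:R - tau].
  rewrite -[X in measurable X]setTI.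
  by apply: (measurable_fun_le (g := fun=> _)).
rewrite EFinD.
apply: le_trans (leeD (sqnorm_upper_tail tau0) (sqnorm_lower_tail tau0)).
apply: (@le_trans _ _ (P ([set w | m%:R + tau <= sqnorm u w]
    `|` [set w | sqnorm u w <= m%:R - tau]))); last exact: measureU2.
apply: le_measure; rewrite ?inE//=.
- apply: measurable_set_ltr => //; apply: measurableT_comp => //.
  exact: measurable_funB.
- exact: measurableU.
- by move=> w /=; rewrite lter_normr => /orP[] ?; [left|right]; lra.
Qed.

End chi_square_concentration.

Lemma tail_sum_lt (R : realType) (m : nat) (tau : R) : (0 < m)%N -> 0 < tau ->
  expR (- Num.min (tau ^+ 2 / (160 * m%:R)) (tau / 10))
    + expR (- (tau ^+ 2 / (40 * m%:R)))
  < 2 * expR (- Num.min (tau ^+ 2 / (160 * m%:R)) (tau / 10)).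
Proof.
move=> m0 tau0; have m0' : 0 < m%:R :> R by rewrite ltr0n.
set e := expR _; suff : expR (- (tau ^+ 2 / (40 * m%:R))) < e by lra.
rewrite ltr_expR ltrN2 gt_min; apply/orP; left.
by rewrite ltr_pM2l ?exprn_gt0// ltf_pV2 ?posrE ?mulr_gt0//; lra.
Qed.

(** * Concentration of [X] and, conditionally on [X], of [A X] *)

Section random_projection.
Import numFieldNormedType.Exports.
Context (R : realType) (d : measure_display) (T : measurableType d).
Variable P : probability T R.
Variables (m n : nat) (x : 'I_n -> T -> R) (S : 'I_m -> 'I_n -> T -> R).
Let Z := fun k : 'I_n + ('I_m * 'I_n) =>
  match k with inl i => x i | inr ij => S ij.1 ij.2 end.
Hypothesis m0 : (0 < m)%N.
Hypothesis n0 : (0 < n)%N.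
Hypothesis Zmeas : forall k, measurable_fun setT (Z k).
Hypothesis Zindep : mutually_independent P Z.
Hypothesis Z1 : forall k, (\int[P]_w (Z k w)%:E = 0)%E.
Hypothesis Z2 : forall k, (\int[P]_w (Z k w ^+ 2)%:E = 1)%E.
Hypothesis Zsg : forall k, subgaussian P 1 (Z k).

Local Notation vec := (g_sigma_algebraType (@boxes R ('I_n + ('I_m * 'I_n))%type)).

Lemma sqnorm_vector_concentration (tau : R) : 0 < tau ->
  (P [set w | tau < `|sqnorm x w - n%:R| ]%R <=
   (expR (- Num.min (tau ^+ 2 / (160 * n%:R)) (tau / 10))
    + expR (- (tau ^+ 2 / (40 * n%:R))))%:E)%E.
Proof.
apply: sqnorm_concentration => //.
- by move=> i; exact: (Zmeas (inl i)).
- by move=> i; exact: (Zsg (inl i)).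
- by move=> i; exact: (Z2 (inl i)).
move=> c.
apply: (@integral_prod_blocks _ _ _ _ _ _ Zmeas Zindep 'I_n
  (fun k => if k is inl i then Some i else None)
  (fun i z => expR (c * z (inl i) ^+ 2))).
- move=> i; apply: measurableT_comp => //; apply: measurable_funM => //.
  by apply: measurable_funX; exact: measurable_vec_coord.
- by move=> i z; exact: expR_ge0.
- by move=> i z z' zz'; rewrite zz'.
Qed.

Lemma sqnorm_projection_concentration (a : 'I_n -> R) (tau : R) :
  \sum_j a j ^+ 2 = 1 -> 0 < tau ->
  (P [set w | tau < `|sqnorm (fun i w => \sum_j a j * S i j w) w - m%:R| ]%R <=
   (expR (- Num.min (tau ^+ 2 / (160 * m%:R)) (tau / 10))
    + expR (- (tau ^+ 2 / (40 * m%:R))))%:E)%E.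
Proof.
move=> a1 tau0.
(* [b] extends [a] to all indices and [J i] is row [i] of [S], so each coordinate of [S a] is a
   linear combination of the family [Z]. *)
pose b (k : 'I_n + ('I_m * 'I_n)) := if k is inr ij then a ij.2 else 0.
pose J (i : 'I_m) := [set (inr (i, j) : 'I_n + ('I_m * 'I_n)) | j : 'I_n]%SET.
have sumJ i (F : 'I_n + ('I_m * 'I_n) -> R) :
    \sum_(k in J i) F k = \sum_j F (inr (i, j)).
  by rewrite big_imset//= => j j' _ _ [].
have uE i : (fun w => \sum_j a j * S i j w) = (fun w => \sum_(k in J i) b k * Z k w).
  by apply/funext => w; rewrite sumJ.
have bJ i : \sum_(k in J i) b k ^+ 2 = 1 by rewrite sumJ.
apply: sqnorm_concentration => //.
- by move=> i; rewrite uE; exact: measurable_lincomb.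
- by move=> i; rewrite uE; exact: subgaussian_lincomb.
- move=> i; have := integral_lincomb_sqr Zmeas Zindep b (J i) Z1 Z2.
  by rewrite bJ => <-; apply: eq_integral => w _; rewrite sumJ.
move=> c.
apply: (@integral_prod_blocks _ _ _ _ _ _ Zmeas Zindep 'I_m
  (fun k => if k is inr ij then Some ij.1 else None)
  (fun i z => expR (c * (\sum_j a j * z (inr (i, j))) ^+ 2))).
- move=> i; apply: measurableT_comp => //; apply: measurable_funM => //.
  apply: measurable_funX; apply: measurable_sum => j.
  by apply: measurable_funM => //; exact: measurable_vec_coord.
- by move=> i z; exact: expR_ge0.
- move=> i z z' zz'; congr (expR (_ * _ ^+ 2)).
  by apply: eq_bigr => j _; rewrite zz'.
Qed.

Lemma sqnormAX_concentration (t : R) : 0 < t ->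
  (P [set w | (sqnorm x w / n%:R * t <
      (Num.sqrt n%:R)^-1 * `|sqnormAX S x w - sqnorm x w|)%R] <=
   (expR (- Num.min ((t * m%:R / Num.sqrt n%:R) ^+ 2 / (160 * m%:R))
                    (t * m%:R / Num.sqrt n%:R / 10))
    + expR (- ((t * m%:R / Num.sqrt n%:R) ^+ 2 / (40 * m%:R))))%:E)%E.
Proof.
move=> t0; set tau := t * m%:R / _; set B := (_ + _).
have m0' : 0 < m%:R :> R by rewrite ltr0n.
have n0' : 0 < n%:R :> R by rewrite ltr0n.
have sn0 : 0 < Num.sqrt n%:R :> R by rewrite sqrtr_gt0.
have sm0 : 0 < Num.sqrt m%:R :> R by rewrite sqrtr_gt0.
have tau0 : 0 < tau by rewrite divr_gt0// mulr_gt0.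
pose xv (j : 'I_n) (z : vec) : R := z (inl j).
pose Sv (i : 'I_m) (j : 'I_n) (z : vec) : R := z (inr (i, j)).
(* The event is viewed as a set of coordinate vectors, so that [integral_decouple] applies to its
   indicator. *)
pose E := [set z : vec | (sqnorm xv z / n%:R * t <
      (Num.sqrt n%:R)^-1 * `|sqnormAX Sv xv z - sqnorm xv z|)%R].
have mxv : measurable_fun setT (sqnorm xv).
  apply: measurable_sum => j; apply: measurable_funX; exact: measurable_vec_coord.
have mSv : measurable_fun setT (sqnormAX Sv xv).
  apply: measurable_sum => i; apply: measurable_funX; apply: measurable_funM => //.
  by apply: measurable_sum => j; apply: measurable_funM; exact: measurable_vec_coord.
have mE : measurable E.
  apply: measurable_set_ltr.
    by apply: measurable_funM => //; exact: measurable_funM.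
  apply: measurable_funM => //; apply: measurableT_comp => //.
  exact: measurable_funB.
have mZ : measurable_fun setT (fun w => (fun k => Z k w) : vec).
  exact: measurable_vec.
have -> : [set w | (sqnorm x w / n%:R * t <
      (Num.sqrt n%:R)^-1 * `|sqnormAX S x w - sqnorm x w|)%R] =
    (fun w => (fun k => Z k w) : vec) @^-1` E by [].
rewrite -[X in P X]setIT.
have mPE : measurable ((fun w => (fun k => Z k w) : vec) @^-1` E).
  by rewrite -[X in measurable X]setTI; exact: mZ.
rewrite -integral_indic//.
rewrite [leLHS](_ : _ = \int[P]_w (\1_E ((fun k => Z k w) : vec))%:E)%E; last first.
  by apply: eq_integral => w _; rewrite !indicE.
(* With this [J], the outer point [w] determines [X] and the inner point [w'] determines [S]; it
   then suffices to bound the inner integral by [B] for every [w]. *)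
pose J : {set 'I_n + ('I_m * 'I_n)} := [set k | if k is inl _ then true else false]%SET.
rewrite (@integral_decouple _ _ _ _ _ _ Zmeas Zindep J
  (fun z => (\1_E z)%:E)); last 2 first.
- by apply/measurable_EFinP; exact: measurable_indic.
- by move=> z; rewrite lee_fin.
apply: (@le_trans _ _ (\int[P]_w B%:E)%E); last first.
  rewrite integral_cst// [X in (_ * X)%E](_ : _ = 1%E) ?mule1//.
  exact: probability_setT.
have mD : measurable_fun setT (decouple Z J) by exact: measurable_decouple.
have mDE : measurable_fun setT (fun w : T * T => (\1_E (decouple Z J w))%:E : \bar R).
  apply/measurable_EFinP.
  by apply: (measurableT_comp (measurable_indic _)) => //.
apply: ge0_le_integral => //.
- by move=> w _; apply: integral_ge0 => w' _; rewrite lee_fin.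
- by apply: (measurable_fun_fubini_tonelli_F (m2 := P) _ mDE) => z; rewrite lee_fin.
move=> w _.
have xvE w' : sqnorm xv (decouple Z J (w, w')) = sqnorm x w.
  by apply: eq_bigr => j _; rewrite /xv /decouple inE.
have SvE w' : sqnormAX Sv xv (decouple Z J (w, w')) =
    \sum_(i < m) ((Num.sqrt m%:R)^-1 * \sum_(j < n) S i j w' * x j w) ^+ 2.
  apply: eq_bigr => i _; congr ((_ * _) ^+ 2); apply: eq_bigr => j _.
  by rewrite /xv /Sv /decouple !inE.
have X0 : 0 <= sqnorm x w by apply: sumr_ge0 => j _; exact: sqr_ge0.
(* If [X] vanishes, both sides of the strict inequality are 0 and the event is empty. *)
have [x0|x0] := eqVneq (sqnorm x w) 0.
  rewrite integral0_eq ?lee_fin ?addr_ge0 ?expR_ge0// => w' _.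
  have xj0 j : x j w = 0.
    apply/eqP; rewrite -sqrf_eq0; apply/eqP.
    by apply: (psumr_eq0P _ x0) => // k _; exact: sqr_ge0.
  rewrite indicE memNset// /E /= xvE SvE x0 !mul0r subr0 big1 ?normr0 ?mulr0 ?ltxx//.
  move=> i _; rewrite big1 ?mulr0 ?expr0n// => j _.
  by rewrite xj0 mulr0.
have {X0 x0}X0 : 0 < sqnorm x w by rewrite lt_def x0.
set X := sqnorm x w in X0 xvE *; pose r := Num.sqrt X.
have r0 : 0 < r by rewrite sqrtr_gt0.
have r2 : r ^+ 2 = X by rewrite sqr_sqrtr// ltW.
have rN0 : r != 0 by rewrite gt_eqF.
pose a j := x j w / r.
have a1 : \sum_j a j ^+ 2 = 1.
  under eq_bigr do rewrite expr_div_n.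
  by rewrite -mulr_suml r2 -/(sqnorm x w) mulfV// gt_eqF.
apply: le_trans (sqnorm_projection_concentration a1 tau0).
set A := [set w' | _].
have AXE w' : sqnormAX Sv xv (decouple Z J (w, w')) =
    X / m%:R * sqnorm (fun i w => \sum_j a j * S i j w) w'.
  rewrite SvE /sqnorm mulr_sumr; apply: eq_bigr => i _.
  have -> : \sum_j S i j w' * x j w = r * \sum_j a j * S i j w'.
    rewrite mulr_sumr; apply: eq_bigr => j _; rewrite /a; field; exact: rN0.
  by rewrite !exprMn exprVn sqr_sqrtr ?ltW// r2 mulrA [m%:R^-1 * X]mulrC.
have AE w' : E (decouple Z J (w, w')) <-> A w'.
  rewrite /E /A /= xvE AXE.
  set Q := sqnorm _ w'.
  have -> : X / m%:R * Q - X = X / m%:R * (Q - m%:R) by field; rewrite gt_eqF.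
  rewrite normrM [`|X / m%:R|]gtr0_norm ?divr_gt0//.
  (* Both sides of the event carry the positive factor [X / (m sqrt n)]; cancelling it leaves the
     threshold [tau], free of [w]. *)
  have -> : X / n%:R * t = X / (m%:R * Num.sqrt n%:R) * tau.
    rewrite /tau -[X in _ / X * t](@sqr_sqrtr _ n%:R) ?ltW//.
    by field; rewrite !gt_eqF.
  have -> : (Num.sqrt n%:R)^-1 * (X / m%:R * `|Q - m%:R|) =
      X / (m%:R * Num.sqrt n%:R) * `|Q - m%:R| by field; rewrite !gt_eqF.
  by rewrite ltr_pM2l// divr_gt0// mulr_gt0.
have mA : measurable A.
  rewrite (_ : A = (fun w' => decouple Z J (w, w')) @^-1` E); last first.
    by apply/seteqP; split => w' /AE.
  by rewrite -[X in measurable X]setTI; exact: (measurableT_comp mD).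
rewrite -[A]setIT -integral_indic//.
rewrite le_eqVlt; apply/orP; left; apply/eqP; apply: eq_integral => w' _.
rewrite !indicE; congr ((nat_of_bool _)%:R%:E).
by apply/idP/idP => /set_mem/AE ?; exact/mem_set.
Qed.

End random_projection.

(** * Rescaling the deviations to the announced thresholds *)

Theorem theorem1 (d : measure_display) (T : measurableType d) (R : realType)
  (P : probability T R) (m n : nat) (hm : (1 <= m)%N) (hn : (1 <= n)%N)
  (x : 'I_n -> T -> R) (S : 'I_m -> 'I_n -> T -> R)
  (Z := fun k : 'I_n + ('I_m * 'I_n) =>
          match k with inl i => x i | inr ij => S ij.1 ij.2 end)
  (Zmeas : forall k, measurable_fun setT (Z k))
  (Zindep : mutually_independent P Z)
  (Zid : identically_distributed P Z)
  (Zmean : forall k, ('E_P[Z k] = 0)%E)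
  (Zvar : forall k, ('V_P[Z k] = 1)%E)
  (Zsg : forall k, subgaussian P 1 (Z k)) :
  let C := (m%:R / n%:R : R) in
  forall t : R, 0 < t ->
    (P [set w | ((Num.sqrt n%:R)^-1 * `|sqnorm x w - n%:R| > t)%R]
       < (2 * expR (- Num.min (t ^+ 2 / 160) (t * Num.sqrt n%:R / 10)))%:E)%E
    /\
    (P [set w | ((Num.sqrt n%:R)^-1 * `|sqnormAX S x w - sqnorm x w|
                  > sqnorm x w / n%:R * t)%R]
       < (2 * expR (- Num.min (t ^+ 2 * C / 160) (t * C * Num.sqrt n%:R / 10)))%:E)%E.
Proof.
move=> C t t0.
have Z1 k : (\int[P]_w (Z k w)%:E = 0)%E by have := Zmean k; rewrite unlock.
have Z2 k : (\int[P]_w (Z k w ^+ 2)%:E = 1)%E.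
  rewrite -(Zvar k) /variance !unlock; apply: eq_integral => w _ /=.
  by rewrite Z1 -[RHS]/(((Z k w - 0) * (Z k w - 0))%:E) subr0 expr2.
have m0 : 0 < m%:R :> R by rewrite ltr0n.
have n0 : 0 < n%:R :> R by rewrite ltr0n.
set q : R := Num.sqrt n%:R.
have q0 : 0 < q by rewrite sqrtr_gt0.
have q2 : n%:R = q ^+ 2 by rewrite sqr_sqrtr// ltW.
split.
  (* The first bound is used at deviation [tau = t sqrt n], the second below at
     [tau = t m / sqrt n]. *)
  have tq0 : 0 < t * q by rewrite mulr_gt0.
  rewrite [X in P X](_ : _ = [set w | t * q < `|sqnorm x w - n%:R| ]); last first.
    by apply/seteqP; split => w /=; rewrite (mulrC q^-1) ltr_pdivlMr.
  apply: (le_lt_trans (sqnorm_vector_concentration hn Zmeas Zindep Z2 Zsg tq0)).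
  have -> : t ^+ 2 / 160 = (t * q) ^+ 2 / (160 * n%:R).
    by rewrite q2; field; rewrite gt_eqF.
  by rewrite lte_fin; exact: tail_sum_lt.
apply: (le_lt_trans (sqnormAX_concentration hm hn Zmeas Zindep Z1 Z2 Zsg t0)).
have tau0 : 0 < t * m%:R / q by rewrite divr_gt0// mulr_gt0.
have -> : t ^+ 2 * C / 160 = (t * m%:R / q) ^+ 2 / (160 * m%:R).
  by rewrite /C q2; field; rewrite !gt_eqF.
have -> : t * C * q / 10 = t * m%:R / q / 10.
  by rewrite /C q2; field; rewrite gt_eqF.
by rewrite lte_fin; exact: tail_sum_lt.
Qed.
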